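(* Let $f(x)=\|x^TQx-z\|$ with global minimizer set $X^*$, and assume that there is $\sigma_0>0$ such that $$f(x)-f(x^* )\ge\sigma_0\,\mathrm{dist}(0,X^* )\,\mathrm{dist}(x,X^* )\qquad\text{for all }x\in\mathbb{R}^n,\ x^*\in X^*,$$ where $\mathrm{dist}(0,X^* )>0$. Let $M>0$, let $p$ be a positive integer, and let $(x_k)_{k\ge 0}$ be generated by the HOPP algorithm. Then, for all $k\ge 0$, $$\frac{\mathrm{dist}(x_k,X^* )}{\mathrm{dist}(0,X^* )}\le\left(\frac{\sigma_0(p+1)}{M\,\mathrm{dist}(0,X^* )^{p-1}}\right)^{\frac1p}\left(\frac{M^{\frac1p}\,\mathrm{dist}(x_0,X^* )}{\big(\sigma_0(p+1)\,\mathrm{dist}(0,X^* )\big)^{\frac1p}}\right)^{(p+1)^k}.$$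
   Context: Given $a_1,\dots,a_m\in\mathbb{R}^n$ and $z=(z_1,\dots,z_m)\in\mathbb{R}^m$ with $z_i$ the measured magnitudes, set $Q_i=a_ia_i^T$ and $x^TQx:=(x^TQ_1x,\dots,x^TQ_mx)^T\in\mathbb{R}^m$; $\|\cdot\|$ is the Euclidean norm. $X^*$ denotes the set of global minimizers of $f$ on $\mathbb{R}^n$, and $\mathrm{dist}(x,X^* )=\inf_{x^*\in X^*}\|x-x^*\|$. HOPP algorithm: given $x_0\in\mathbb{R}^n$, a positive integer $p$ and $M>0$, for each $k\ge 0$ let $x_{k+1}$ be any global minimizer, i.e. $$x_{k+1}\in\arg\min_{x\in\mathbb{R}^n}\left\|x^TQx-z\right\|+\frac{M}{p+1}\|x-x_k\|^{p+1}.$$ *)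

(* Defs.v *)
From HB Require Import structures.
From mathcomp Require Import all_boot all_order all_algebra.
From mathcomp Require Import boolp classical_sets reals.

Set Implicit Arguments.
Unset Strict Implicit.
Unset Printing Implicit Defensive.
Import Order.TTheory GRing.Theory Num.Theory.
Local Open Scope classical_set_scope.
Local Open Scope ring_scope.

(* The Euclidean norm; the norm [`|v|] that MathComp-Analysis puts on
   matrices is the sup norm. *)
Definition enorm (R : realType) (n : nat) (v : 'cV[R]_n) : R :=
  Num.sqrt (\sum_(i < n) v i 0 ^+ 2).

(* [inf] is the real infimum, with the convention [inf set0 = 0]. *)
Definition edist (R : realType) (n : nat) (x : 'cV[R]_n)
    (A : set 'cV[R]_n) : R :=
  inf [set enorm (x - y) | y in A].

Definition argmin (R : realType) (n : nat) (F : 'cV[R]_n -> R) :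
    set 'cV[R]_n :=
  [set x | forall y, F x <= F y].

Definition Qmx (R : realType) (m n : nat) (a : 'I_m -> 'cV[R]_n)
    (i : 'I_m) : 'M[R]_n :=
  a i *m (a i)^T.

Definition xQx (R : realType) (m n : nat) (a : 'I_m -> 'cV[R]_n)
    (x : 'cV[R]_n) : 'cV[R]_m :=
  \col_(i < m) (x^T *m Qmx a i *m x) 0 0.

Definition fobj (R : realType) (m n : nat) (a : 'I_m -> 'cV[R]_n)
    (z : 'cV[R]_m) (x : 'cV[R]_n) : R :=
  enorm (xQx a x - z).

Definition hopp_seq (R : realType) (m n : nat) (a : 'I_m -> 'cV[R]_n)
    (z : 'cV[R]_m) (p : nat) (M : R) (x : nat -> 'cV[R]_n) : Prop :=
  forall k, argmin
    (fun y => fobj a z y + M / p.+1%:R * enorm (y - x k) ^+ p.+1) (x k.+1).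

(* Main.v *)
Require Import Defs.
From HB Require Import structures.
From mathcomp Require Import all_boot all_order all_algebra.
From mathcomp Require Import boolp classical_sets reals exp.
From mathcomp Require Import ring.
Set Implicit Arguments.
Unset Strict Implicit.
Unset Printing Implicit Defensive.
Import Order.TTheory GRing.Theory Num.Theory.
Local Open Scope classical_set_scope.
Local Open Scope ring_scope.

(** Comparing x_{k+1} with a minimizer xs of f gives
    f(x_{k+1}) - f(xs) <= M/(p+1) |xs - x_k|^(p+1). Taking the infimum over xs
    and using sharpness, the distances d_k = dist(x_k, X^* ) satisfy
    d_{k+1} <= C d_k^(p+1) with C = M / (sigma0 (p+1) dist(0, X^* )), so that
    u_k = C^(1/p) d_k satisfies u_{k+1} <= u_k^(p+1). *)

Lemma enormB (R : realType) (n : nat) (x y : 'cV[R]_n) :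
  enorm (x - y) = enorm (y - x).
Proof.
rewrite /enorm; congr Num.sqrt; apply: eq_bigr => i _.
by rewrite !mxE -sqrrN opprB.
Qed.

Lemma edist_ge0 (R : realType) (n : nat) (x : 'cV[R]_n) (A : set 'cV[R]_n) :
  0 <= edist x A.
Proof.
(* The empty set is treated apart: there the infimum is 0 by convention, while the lower-bound
   argument needs a point of [A]. *)
have [->|A0] := eqVneq A set0; first by rewrite /edist image_set0 inf0.
apply: lb_le_inf; first by have /set0P[y Ay] := A0; exists (enorm (x - y)), y.
by move=> _ [y _ <-]; exact: sqrtr_ge0.
Qed.

Lemma powR_invnK (R : realType) (n : nat) (c : R) :
  (0 < n)%N -> 0 <= c -> (c `^ n%:R^-1) ^+ n = c.
Proof.
move=> n0 c0; rewrite -powR_mulrn ?powR_ge0// -powRrM mulVf ?powRr1//.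
by rewrite pnatr_eq0 -lt0n.
Qed.

Lemma powRnK (R : realType) (n : nat) (c : R) :
  (0 < n)%N -> 0 <= c -> (c ^+ n) `^ n%:R^-1 = c.
Proof.
move=> n0 c0; rewrite -powR_mulrn// -powRrM divff ?powRr1//.
by rewrite pnatr_eq0 -lt0n.
Qed.

Lemma powRV (R : realType) (c r : R) : 0 <= c -> c^-1 `^ r = (c `^ r)^-1.
Proof. by move=> c0; rewrite -powR_inv1// powRAC powR_inv1 ?powR_ge0. Qed.

(** The infimum need not be known to be attained, so the bound passes through the [q]-th root of
    [c]: it bounds every [enorm (x - y)] from below, hence also their infimum. *)
Lemma le_edistX (R : realType) (n q : nat) (x : 'cV[R]_n) (A : set 'cV[R]_n)
    (c : R) :
  (0 < q)%N -> A !=set0 -> 0 <= c ->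
  (forall y, A y -> c <= enorm (x - y) ^+ q) -> c <= edist x A ^+ q.
Proof.
move=> q0 [y0 Ay0] c0 hc.
rewrite -(powR_invnK q0 c0) lerXn2r ?nnegrE ?powR_ge0 ?edist_ge0//.
apply: lb_le_inf; first by exists (enorm (x - y0)), y0.
move=> _ [y Ay <-]; rewrite -(@ler_pXn2r _ q) ?nnegrE ?powR_ge0 ?sqrtr_ge0//.
by rewrite powR_invnK// hc.
Qed.

(** Multiplying the recurrence by [c] makes its right side exactly [(c * d k) ^+ p.+1], so each step
    multiplies the exponent by [p + 1]. *)
Lemma superlinear_recurrence (R : realType) (p : nat) (c : R) (d : nat -> R) :
  0 <= c -> (forall k, 0 <= d k) ->
  (forall k, d k.+1 <= c ^+ p * d k ^+ p.+1) ->
  forall k, c * d k <= (c * d 0%N) ^+ ((p + 1) ^ k).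
Proof.
move=> c0 d0 hd; elim=> [|k IHk]; first by rewrite expr1.
rewrite expnSr exprM addn1.
apply: (@le_trans _ _ ((c * d k) ^+ p.+1)); last first.
  by rewrite -addn1 lerXn2r ?nnegrE ?exprn_ge0 ?mulr_ge0.
by rewrite exprMn exprS -mulrA ler_wpM2l.
Qed.

Theorem theorem6p3 (R : realType) (m n : nat) (a : 'I_m -> 'cV[R]_n)
    (z : 'cV[R]_m) (Xs : set 'cV[R]_n) (hXs : Xs = argmin (fobj a z))
    (sigma0 : R) (hsigma0 : 0 < sigma0)
    (hsharp : forall x xs : 'cV[R]_n, Xs xs ->
      sigma0 * edist 0 Xs * edist x Xs <= fobj a z x - fobj a z xs)
    (hdist0 : 0 < edist 0 Xs)
    (M : R) (hM : 0 < M) (p : nat) (hp : (0 < p)%N)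
    (x : nat -> 'cV[R]_n) (hx : hopp_seq a z p M x) :
  forall k : nat,
    edist (x k) Xs / edist 0 Xs <=
      (sigma0 * p.+1%:R / (M * edist 0 Xs ^+ (p - 1))) `^ (p%:R^-1) *
      (M `^ (p%:R^-1) * edist (x 0%N) Xs /
         (sigma0 * p.+1%:R * edist 0 Xs) `^ (p%:R^-1)) ^+ ((p + 1) ^ k).
Proof.
have Xs0 : Xs !=set0.
  (* If [Xs] were empty, [edist 0 Xs] would take the default value 0, against [hdist0]. *)
  by apply/set0P/eqP => E; move: hdist0; rewrite E /edist image_set0 inf0 ltxx.
set D := edist 0 Xs in hsharp hdist0 *.
set S := sigma0 * p.+1%:R.
have S0 : 0 < S by rewrite mulr_gt0.
have SD0 : 0 < S * D by rewrite mulr_gt0.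
set r := p%:R^-1.
have step k : edist (x k.+1) Xs <= M / (S * D) * edist (x k) Xs ^+ p.+1.
  rewrite -ler_pdivrMl ?divr_gt0//; apply: le_edistX => //.
    by rewrite mulr_ge0 ?edist_ge0// invr_ge0 divr_ge0 ?ltW.
  move=> xs Xxs.
  (* The constant splits into the inverse of the sharpness modulus and the weight of the proximal
     term. *)
  have -> : M / (S * D) = (sigma0 * D)^-1 * (M / p.+1%:R).
    by rewrite /S [sigma0 * _ * D]mulrAC invfM mulrCA.
  have sD0 : 0 < sigma0 * D by rewrite mulr_gt0.
  have Mp0 : 0 < M / p.+1%:R by rewrite divr_gt0.
  rewrite invfM invrK mulrAC ler_pdivrMr// [_ * (M / _)]mulrC.
  apply: le_trans (hsharp _ _ Xxs) _.
  rewrite enormB lerBlDl; apply: le_trans (hx k xs).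
  by rewrite lerDl mulr_ge0 ?exprn_ge0 ?sqrtr_ge0 ?ltW.
move=> k.
set c := (M / (S * D)) `^ r.
have c0 : 0 < c by rewrite powR_gt0 ?divr_gt0.
have cp : c ^+ p = M / (S * D) by rewrite powR_invnK ?divr_ge0 ?ltW.
have := @superlinear_recurrence R p c (fun k => edist (x k) Xs) (ltW c0)
  (fun k => edist_ge0 _ _).
rewrite cp => /(_ step k) hk.
have -> : M `^ r * edist (x 0%N) Xs / (S * D) `^ r = c * edist (x 0%N) Xs.
  by rewrite mulrAC /c [(M / _) `^ _]powRM ?invr_ge0 ?ltW// powRV ?ltW.
have -> : (S / (M * D ^+ (p - 1))) `^ r = (c * D)^-1.
  have -> : S / (M * D ^+ (p - 1)) = (M / (S * D) * D ^+ p)^-1.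
    (* Since [p] is positive, [D ^+ p] factors as [D ^+ (p - 1) * D], and the extra [D] cancels the
       one in [S * D]. *)
    rewrite -{2}(subnK hp) exprD expr1; field.
    by rewrite expf_neq0 ?gt_eqF.
  have C0 : 0 <= M / (S * D) by rewrite divr_ge0 ?ltW.
  have Dp0 : 0 <= D ^+ p by rewrite exprn_ge0 ?ltW.
  by rewrite powRV; [rewrite powRM// powRnK ?ltW|exact: mulr_ge0].
(* With prefactor [(c * D)^-1] and base [c * edist (x 0%N) Xs], cancelling [D] and moving [c] to the
   left gives [hk]. *)
by rewrite invfM mulrAC ler_pM2r ?invr_gt0// ler_pdivlMl.
Qed.
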